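(* Let $\mathbf{P}$ be a general bond percolation on a graph $G=(V,E)$. Then the function $k\colon V\times V\to[0,1]$, $k(u,v):=\mathbf{P}[u\not\leftrightarrow v]$, is a measure definite kernel on $V$.
   Context: A general bond percolation on a graph $G=(V,E)$ is a probability measure $\mathbf{P}$ on subsets of $E$, i.e. on $\{0,1\}^E$ with its Borel $\sigma$-algebra. The configuration $\omega\subset E$ is identified with the induced subgraph with vertex set $V$ and edge set $\omega$; its connected components are called clusters. $\{u\leftrightarrow v\}$ is the event that $u$ and $v$ lie in the same cluster of $\omega$, and $\{u\not\leftrightarrow v\}$ is its complement. A map $k\colon X\times X\to[0,\infty)$ on a set $X$ is a measure definite kernel if there exist a measure space $(\Omega,\mathcal{B},\mu)$ and a map $S\colon X\to\mathcal{B}$, $x\mapsto S_x$, such that $k(x,y)=\mu(S_x\Delta S_y)$ for every $x,y\in X$, where $\Delta$ denotes symmetric difference. *)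

(* Defs.v *)
From HB Require Import structures.
From Stdlib Require Import Relation_Operators.
From mathcomp Require Import all_boot all_order all_algebra.
From mathcomp Require Import all_classical all_reals all_analysis.

Set Implicit Arguments.
Unset Strict Implicit.
Unset Printing Implicit Defensive.

Import Order.TTheory GRing.Theory Num.Theory.

Local Open Scope classical_set_scope.
Local Open Scope ring_scope.

(* No cardinality or finiteness assumption is made, and loops and multiple
   edges are allowed; a simple graph whose edge set is a family [F] of unordered
   pairs is the case where [edge] is the subtype of [F] and [ends] the inclusion. *)
Record graph := Graph {
  vertex : Type ;
  edge : Type ;
  ends : edge -> set vertex ;
  ends_pair : forall e, exists u v, ends e = [set u; v] }.

(* {0,1}^E with the product topology of the discrete space {0,1} *)
Definition config (G : graph) : Type := {ptws edge G -> bool}.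
HB.instance Definition _ (G : graph) := Topological.on (config G).
HB.instance Definition _ (G : graph) :=
  isPointed.Build (config G) (fun=> false).

(* {0,1}^E with its Borel sigma-algebra, which for an uncountable edge set is
   larger than the product sigma-algebra *)
Definition borel_config (G : graph) :=
  g_sigma_algebraType (@open (config G)).

Definition percolation (G : graph) (R : realType) :=
  probability (borel_config G) R.

Section clusters.
Variable G : graph.

Definition open_adj (omega : config G) (u v : vertex G) : Prop :=
  exists e : edge G, omega e /\ ends e = [set u; v].

(* the connected component of u in the subgraph (V, omega); since [open_adj] is
   symmetric, its reflexive-transitive closure is an equivalence relation *)
Definition open_cluster (omega : config G) (u : vertex G) : set (vertex G) :=
  [set v | clos_refl_trans _ (open_adj omega) u v].

Definition connection (u v : vertex G) : set (borel_config G) :=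
  [set omega | open_cluster omega u v].

Definition disconnection (u v : vertex G) : set (borel_config G) :=
  ~` connection u v.

Lemma open_connection u v : open (connection u v : set (config G)).
Proof.
rewrite openE => omega /= uv; rewrite /interior /=.
elim: {u v} uv => [u v [e [oe ee]]|u|u w v _ IH1 _ IH2].
- have : nbhs omega [set o : config G | o e].
    apply: (@proj_continuous {classic edge G} (fun=> bool) e omega [set true]).
    by apply: open_nbhs_nbhs; split; [exact: discrete_open | exact: oe].
  by apply: filterS => o /= oe'; apply: rt_step; exists e.
- by apply: filterS filterT => o _; exact: rt_refl.
- by apply: filterS2 IH1 IH2 => o /= h1 h2; exact: rt_trans h1 h2.
Qed.

Lemma measurable_disconnection u v : measurable (disconnection u v).
Proof.
by apply: measurableC; apply: sub_sigma_algebra; exact: open_connection.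
Qed.

End clusters.

(* nonnegativity of k is forced, the right-hand side being a measure *)
Definition measure_definite_kernel (R : realType) (X : Type)
    (k : X -> X -> R) : Prop :=
  exists (d : measure_display) (Omega : measurableType d)
         (mu : {measure set Omega -> \bar R}) (S : X -> set Omega),
    (forall x, measurable (S x)) /\
    (forall x y, (k x y)%:E = mu (S x `+` S y)).

(* Main.v *)
Require Import Defs.
From HB Require Import structures.
From Stdlib Require Import Relation_Operators.
From mathcomp Require Import all_boot all_order all_algebra.
From mathcomp Require Import all_classical all_reals all_analysis.

(** Fix a configuration omega. Of the clusters of omega, either one contains both
    u and v, or exactly two contain just one of them. Hence, with N the measure
    counting the clusters of omega on the set of all subsets C of V, and with
    [S_u] the family of the sets C that contain u, the number N(S_u `+` S_v) / 2
    is the indicator of the event that u and v are not connected. Averaging over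
    omega, k(u,v) is the value at [S_u `+` S_v] of mu := E[N] / 2.

    When V is uncountable, the number of clusters lying in a given family of sets
    involves uncountably many events and is not evidently a measurable function
    of omega, so mu is not defined as this expectation. Its restriction to [S_u]
    is nevertheless known: the only cluster of omega in [S_u] is the cluster of u,
    so there mu has to be m_u, half of the law of the cluster of u. The measures
    m_u and m_v agree on the subsets of
    [S_u `&` S_v], because a cluster that contains u and v is the cluster of both.
    It remains to find a measure on the sigma-algebra generated by the sets [S_u]
    with these restrictions, and this holds for every compatible family of
    measures ([glue_measures]): finitely many of them are glued by cutting a
    finite union of sets [S_i] into disjoint pieces, and the measures so obtained
    form an upward directed family, whose pointwise supremum is a measure
    ([directed_sup_measure]). *)

Import Order.TTheory GRing.Theory Num.Theory.

Local Open Scope classical_set_scope.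
Local Open Scope ring_scope.

(** * Suprema of directed families of measures *)

Section directed_sup.
Local Open Scope ereal_scope.

Lemma le_ereal_sup_range {R : realType} {I : Type} (f : I -> \bar R) (i : I) :
  f i <= ereal_sup (range f).
Proof. by apply: ereal_sup_ubound; exists i. Qed.

(** Directedness is what makes the supremum additive: [a i] and [b j],
    taken at different indices, are dominated at a common one. *)
Lemma directed_ereal_supD {R : realType} {I : Type} (a b : I -> \bar R) :
  (forall i, 0 <= a i) -> (forall i, 0 <= b i) ->
  (forall i j, exists k, a i <= a k /\ b j <= b k) ->
  ereal_sup (range a) + ereal_sup (range b) <=
  ereal_sup (range (fun i => a i + b i)).
Proof.
move=> a0 b0 dir; set s := ereal_sup (range (fun i => a i + b i)).
have ab i j : a i + b j <= s.
  have [k [aik bjk]] := dir i j.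
  apply: le_trans (le_ereal_sup_range (fun i => a i + b i) k).
  exact: leeD.
have supa j : ereal_sup (range a) + b j <= s.
  have [bfin|] := boolP (b j \is a fin_num).
    rewrite -leeBrDr//; apply/ereal_supP => _ [i _ <-].
    by rewrite leeBrDr.
  rewrite ge0_fin_numE// -leNgt leye_eq => /eqP bjy.
  have aN : a j != -oo by rewrite -ltNye (lt_le_trans _ (a0 j)).
  by have := ab j j; rewrite bjy addey// leye_eq => /eqP ->; rewrite leey.
have [afin|] := boolP (ereal_sup (range a) \is a fin_num).
  rewrite -leeBrDl//; apply/ereal_supP => _ [j _ <-].
  by rewrite leeBrDl.
have [[i0]|I0] := pselect (inhabited I); last first.
  have -> : range a = set0 by rewrite -subset0 => x [i]; case: I0; exists.
  by rewrite ereal_sup0 addNye leNye.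
have a0' : 0 <= ereal_sup (range a) := le_trans (a0 i0) (le_ereal_sup_range a i0).
rewrite ge0_fin_numE// -leNgt leye_eq => /eqP ay.
have bN : b i0 != -oo by rewrite -ltNye (lt_le_trans _ (b0 i0)).
by have := supa i0; rewrite ay addye// leye_eq => /eqP ->; rewrite leey.
Qed.

(** Finite additivity, hence superadditivity along every partial sum, comes from
    [directed_ereal_supD]; countable subadditivity holds for any supremum of
    measures. *)
Lemma directed_sup_measure {d} {T : measurableType d} {R : realType} {I : Type}
    (i0 : I) (m : I -> {measure set T -> \bar R}) :
  (forall i j, exists k, forall A, measurable A ->
    m i A <= m k A /\ m j A <= m k A) ->
  exists mu : {measure set T -> \bar R},
    forall A, mu A = ereal_sup (range (fun i => m i A)).
Proof.
move=> dir; pose mu A := ereal_sup (range (fun i => m i A)).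
have mu0 : mu set0 = 0.
  apply/eqP; rewrite eq_le; apply/andP; split.
    by apply/ereal_supP => _ [i _ <-]; rewrite measure0.
  by apply: le_trans (le_ereal_sup_range (fun i => m i set0) i0).
have mu_ge0 A : 0 <= mu A.
  by apply: le_trans (le_ereal_sup_range (fun i => m i A) i0).
have mu_sum (F : nat -> set T) n : (forall k, measurable (F k)) ->
    \sum_(0 <= k < n) mu (F k) <=
    ereal_sup (range (fun i => \sum_(0 <= k < n) m i (F k))).
  move=> mF; elim: n => [|n IH].
    rewrite big_geq//; apply: le_trans (le_ereal_sup_range _ i0).
    by rewrite big_geq.
  rewrite big_nat_recr//=.
  under [X in range X]eq_fun do rewrite big_nat_recr//=.
  apply: le_trans (directed_ereal_supD _ _ _ _ _).
  - by rewrite leeD2r.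
  - by move=> i; apply: sume_ge0.
  - by [].
  - move=> i j; have [k dirk] := dir i j; exists k; split.
      by apply: lee_sum => l _; have [] := dirk _ (mF l).
    by have [] := dirk _ (mF n).
have mu_add : semi_sigma_additive mu.
  move=> F mF tF mUF.
  have m_bigcup i : m i (\bigcup_n F n) = \sum_(0 <= n <oo) m i (F n).
    by apply/esym/cvg_lim => //; exact: measure_semi_sigma_additive.
  suff -> : mu (\bigcup_n F n) = \sum_(0 <= n <oo) mu (F n).
    by apply: is_cvg_nneseries => n _ _.
  apply/eqP; rewrite eq_le; apply/andP; split.
    apply/ereal_supP => _ [i _ <-]; rewrite m_bigcup.
    apply: lee_nneseries => // n _.
    exact: (le_ereal_sup_range (fun i => m i (F n))).
  apply: lime_le; first by apply: is_cvg_nneseries => n _ _.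
  apply: nearW => n; apply: le_trans (mu_sum F n mF) _.
  apply/ereal_supP => _ [i _ <-].
  apply: le_trans (le_ereal_sup_range (fun i => m i (\bigcup_n F n)) i).
  by rewrite m_bigcup; apply: nneseries_lim_ge.
pose muM : {measure set T -> \bar R} :=
  HB.pack mu (isMeasure.Build d T R mu mu0 mu_ge0 mu_add).
by exists muM.
Qed.

End directed_sup.

(** * Glueing compatible measures *)

Section glueing.
Local Open Scope ereal_scope.
Context {d} {T : measurableType d} {R : realType} {I : Type}.
Variables (S : I -> set T) (m : I -> {measure set T -> \bar R}).
Hypothesis mS : forall i, measurable (S i).
Hypothesis compatible : forall i j B, measurable B ->
  B `<=` S i -> B `<=` S j -> m i B = m j B.

Definition union_of (s : seq I) : set T := \big[setU/set0]_(i <- s) S i.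

Lemma measurable_union_of s : measurable (union_of s).
Proof. exact: bigsetU_measurable. Qed.

Lemma union_of_cons i s :
  union_of (i :: s) = union_of s `|` (S i `\` union_of s).
Proof. by rewrite /union_of big_cons setUC setDE setUIr setUv setIT. Qed.

Let measurable_new i s : measurable (S i `\` union_of s).
Proof. exact: measurableD (mS i) (measurable_union_of s). Qed.

Fixpoint glue (s : seq I) : {measure set T -> \bar R} :=
  if s is i :: s' then measure_add (glue s') (mrestr (m i) (measurable_new i s'))
  else mzero.

Lemma glue_cons i s A :
  glue (i :: s) A = glue s A + m i (A `&` (S i `\` union_of s)).
Proof. exact: measure_addE. Qed.

Lemma measure_cut (mu : {measure set T -> \bar R}) i s A : measurable A ->
  mu (A `&` union_of (i :: s)) =
  mu (A `&` union_of s) + mu (A `&` (S i `\` union_of s)).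
Proof.
move=> mA; rewrite union_of_cons setIUr measureU//.
- exact: measurableI mA (measurable_union_of s).
- exact: measurableI mA (measurable_new i s).
- by rewrite -subset0 => x [[_ ?] [_ []]].
Qed.

(** By compatibility, on a subset of [S i] each piece of the cut may be measured
    by [m i], whatever measure was assigned to it. *)
Lemma glue_local i s B : measurable B -> B `<=` S i ->
  glue s B = m i (B `&` union_of s).
Proof.
move=> mB BS; elim: s => [|j s IH].
  by rewrite /union_of big_nil setI0 measure0.
rewrite glue_cons IH measure_cut//; congr (_ + _).
apply: compatible; first exact: measurableI mB (measurable_new j s).
- by move=> x [_ []].
- by move=> x [/BS].
Qed.

(** The glued measure depends on the list only through the union that it covers:
    this is what makes the family [glue] directed. *)
Lemma glue_sub s t A : measurable A -> union_of s `<=` union_of t ->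
  glue t (A `&` union_of s) = glue s A.
Proof.
move=> mA; elim: s => [|i s IH] st.
  by rewrite /union_of big_nil setI0 measure0.
have sub_s : union_of s `<=` union_of t.
  by apply: subset_trans st; rewrite union_of_cons; exact: subsetUl.
rewrite glue_cons measure_cut// (IH sub_s).
congr (_ + _); rewrite (glue_local i).
- congr (m i _); apply/setIidPl => x [_ Sx]; apply: st.
  by rewrite union_of_cons; right.
- exact: measurableI mA (measurable_new i s).
- by move=> x [_ []].
Qed.

Lemma le_glue s t A : measurable A -> union_of s `<=` union_of t ->
  glue s A <= glue t A.
Proof.
move=> mA st; rewrite -(glue_sub s t)//; apply: le_measure; rewrite ?inE//.
exact: measurableI mA (measurable_union_of s).
Qed.

(** The supremum over all finite lists keeps the prescribed values: on subsets of
    [S i] no list exceeds [m i], and the list reduced to i attains it. *)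
Lemma glue_measures : exists mu : {measure set T -> \bar R},
  forall i B, measurable B -> B `<=` S i -> mu B = m i B.
Proof.
have [|mu muE] := directed_sup_measure [::] glue.
  move=> s t; exists (s ++ t) => A mA; rewrite /=.
  by split; apply: le_glue => //; rewrite /union_of big_cat;
     [exact: subsetUl|exact: subsetUr].
exists mu => i B mB BS; rewrite muE; apply/eqP; rewrite eq_le; apply/andP; split.
  apply/ereal_supP => _ [s _ <-]; rewrite (glue_local i)//.
  apply: le_measure; rewrite ?inE//.
  exact: measurableI mB (measurable_union_of s).
apply: le_trans (le_ereal_sup_range (fun s => glue s B) [:: i]).
by rewrite (glue_local i)// /union_of big_seq1 setIidl.
Qed.

End glueing.

(** * The random cluster of a vertex *)

Section cluster_measure.
Context {G : graph}.

Lemma open_cluster_sym (omega : config G) u v :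
  open_cluster omega u v -> open_cluster omega v u.
Proof.
elim=> [x y [e [oe ends_e]]|x|x y z _ yx _ zy].
- by apply: rt_step; exists e; split=> //; rewrite ends_e setUC.
- exact: rt_refl.
- exact: rt_trans zy yx.
Qed.

Lemma eq_open_cluster (omega : config G) u v :
  open_cluster omega u v -> open_cluster omega u = open_cluster omega v.
Proof.
move=> uv; apply/seteqP; split=> w; last exact: rt_trans uv.
exact: rt_trans (open_cluster_sym _ _ _ uv).
Qed.

(** The sigma-algebra on subsets of V is only generated by the events that the
    set contains a given vertex: were every family of subsets measurable,
    [cluster_of] would fail to be measurable at the centre of an infinite star,
    where the cluster determines the configuration. *)
Definition vertex_sets :=
  g_sigma_algebraType (range (fun u : vertex G => [set C : set (vertex G) | C u])).

Definition containing (u : vertex G) : set vertex_sets := [set C | C u].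

Lemma measurable_containing u : measurable (containing u).
Proof. by apply: sub_sigma_algebra; exists u. Qed.

Definition cluster_of (u : vertex G) (omega : borel_config G) : vertex_sets :=
  open_cluster omega u.

Lemma measurable_cluster_of u : measurable_fun setT (cluster_of u).
Proof.
apply: (@measurability _ _ _ vertex_sets _ _
  (range (fun v : vertex G => [set C : set (vertex G) | C v])))
  => // _ [_ [v _ <-] <-].
by rewrite setTI; apply: sub_sigma_algebra; exact: open_connection.
Qed.

HB.instance Definition _ u :=
  isMeasurableFun.Build _ _ _ _ (cluster_of u) (measurable_cluster_of u).

End cluster_measure.

Theorem lemma3p1 (R : realType) (G : graph) (P : percolation G R) :
  let k : vertex G -> vertex G -> R := fun u v => fine (P (disconnection u v)) in
  (forall u v, 0 <= k u v <= 1) /\ measure_definite_kernel k.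
Proof.
move=> k.
have kE u v : (k u v)%:E = P (disconnection u v).
  by rewrite fineK// fin_num_measure//; exact: measurable_disconnection.
split=> [u v|].
  rewrite -!lee_fin kE measure_ge0/= probability_le1//.
  exact: measurable_disconnection.
have half_ge0 : 0 <= 2^-1 :> R by rewrite invr_ge0.
pose m (u : vertex G) : {measure set vertex_sets -> \bar R} :=
  mscale (NngNum half_ge0) (distribution P (cluster_of u)).
have mE u B : m u B = ((2^-1)%:E * P (cluster_of u @^-1` B))%E by [].
have compatible u v B : measurable B -> B `<=` containing u ->
    B `<=` containing v -> m u B = m v B.
  move=> _ Bu Bv; rewrite !mE; congr (_ * P _)%E.
  apply/seteqP; split=> omega Bo; rewrite /preimage/= /cluster_of.
    by rewrite -(eq_open_cluster _ u v)//; exact: Bv.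
  by rewrite -(eq_open_cluster _ v u)//; exact: Bu.
have [mu muE] := glue_measures _ m measurable_containing compatible.
(* a cluster containing u but not v is the cluster of u, on the event that u
   and v are disconnected *)
have separated u v : mu (containing u `\` containing v) =
    ((2^-1)%:E * P (disconnection u v))%E.
  rewrite (muE u); first last.
  - by move=> C [].
  - exact: measurableD (measurable_containing u) (measurable_containing v).
  rewrite mE; congr (_ * P _)%E; apply/seteqP; split=> omega.
    by case.
  by split=> //; exact: rt_refl.
exists _, vertex_sets, mu, containing; split=> [|u v].
  exact: measurable_containing.
have dC : disconnection v u = disconnection u v.
  by apply/seteqP; split=> omega; apply: contra_not => /open_cluster_sym.
rewrite kE.
transitivity (mu (containing u `\` containing v) +
              mu (containing v `\` containing u))%E.
  rewrite !separated dC -ge0_muleDl ?lee_fin// -EFinD.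
  by rewrite -[2^-1 in RHS]mul1r -splitr mul1e.
apply/esym/measureU.
- exact: measurableD (measurable_containing u) (measurable_containing v).
- exact: measurableD (measurable_containing v) (measurable_containing u).
- by rewrite -subset0 => C [[Cu _] [_ []]].
Qed.
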